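(* For every integer $j$ with $j\neq 0,-1$ and each $\mathcal{X}\in\{\mathrm{IX},\mathrm{X}\}$, the area of the region of the generalized L-shaped curve $P_{\mathcal{X}}(j)$, the number of concave points of this region, and the coefficient of the lens space surgery along the knot $k_{\mathcal{X}}(j)$ presented by $P_{\mathcal{X}}(j)$ satisfy $$\bigl[\,\text{Area}-\sharp\{\text{Concave points}\}\,\bigr]-\text{Surgery coefficient}\ =\ 0\ \text{ or }\ 1 .$$
   Context: **Regions.** Let $n\ge 1$ and let $[(a_i,b_i)]=[(a_1,b_1),\dots,(a_n,b_n)]$ be points of $\mathbb{Z}^2$ with $0<a_1<\cdots<a_n$ and $b_1>\cdots>b_n>0$. The generalized L-shaped region of type $[(a_i,b_i)]$ is $$R[(a_i,b_i)]=\bigcup_{i=1}^n\{(x,y)\in\mathbb{R}^2:0\le x\le a_i,\ 0\le y\le b_i\}.$$ A boundary point $p$ of a region is a concave point if near $p$ the region looks like $\{x\le0\}\cup\{y\le0\}$ near $(0,0)$, up to the symmetries generated by the reflection $(x,y)\mapsto(-x,y)$, the rotation by $\pi/2$ and integer translations (i.e. interior angle $3\pi/2$). The curve defined by a region $R$ whose concave points all have the same parity (parity of $(k,l)$ is that of $k+l$) is whichever of $X\cap R$, $X\cap(R+(1,0))$ has the concave points at odd points, where $X=\{\cos\pi x=\cos\pi y\}$; for $R=R[(a_i,b_i)]$ it is called the generalized L-shaped curve of type $[(a_i,b_i)]$. **The curves $P(j)$.** For an integer $j\ne 0,-1$ define a sequence $[(a_i,b_i)^{(j)}]$ as follows. If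 $j>0$, the length is $j+1$; $[(a_i,b_i)^{(1)}]=[(1,3),(2,1)]$, and for $j\geq 2$ inductively $(a_1,b_1)^{(j)}=(1,2j+1)$ and $(a_i,b_i)^{(j)}=(b_{j+2-i},a_{j+2-i})^{(j-1)}+(1,1)$ for $1<i\le j+1$. If $j<-1$, the length is $-j$ and $(a_i,b_i)^{(j)}=(2i,-2j+1-2i)$ for $1\le i\le -j$. $P(j)$ is the generalized L-shaped curve of type $[(a_i,b_i)^{(j)}]$. Its region has bottom edge $E_a$ of length $A=|2j|$ and left edge $E_b$ of length $B=|2j+1|$. **The curves $P_{\mathcal{X}}(j)$.** Adding a square along the bottom (resp. left) edge of a region means gluing, on the outside of the region, a square having that whole edge as a side. $P_{\mathrm{IX}}(j)$: to the region of $P(j)$ add a square (of side $A$) along $E_a$, and then a square (of side $A+B$) along the lengthened left edge. $P_{\mathrm{X}}(j)$: add a square (of side $B$) along $E_b$, and then a square (of side $A+B$) along the lengthened bottom edge. In each case take the curve defined by the resulting region. After translation to the origin these are the generalized L-shaped curves of types $[(a_i+A+B,\ b_i+A)]$ for $P_{\mathrm{IX}}(j)$ and $[(a_i+B,\ b_i+A+B)]$ for $P_{\mathrm{X}}(j)$, where $(a_i,b_i)=(a_i,b_i)^{(j)}$. **Knots and coefficients.** $k_{\mathrm{IX}}(j)$ and $k_{\mathrm{X}}(j)$, $j\ne0,-1$, are the sporadic knots of Types IX and X in Berge's list of lens space surgeries. The coefficient of the lens space surgery along $k_{\mathrm{IX}}(j)$ (in Berge's list) is $22j^2+9j+1$,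 and that along $k_{\mathrm{X}}(j)$ is $22j^2+13j+2$. The curve $P_{\mathcal{X}}(j)$ presents $k_{\mathcal{X}}(j)$ as a divide knot in the sense of A'Campo. *)

(* Defs.v *)
From HB Require Import structures.
From mathcomp Require Import all_boot all_order all_algebra.
From mathcomp Require Import all_classical all_reals all_analysis.

Set Implicit Arguments.
Unset Strict Implicit.
Unset Printing Implicit Defensive.

Import Order.TTheory GRing.Theory Num.Theory.
Import numFieldNormedType.Exports.

Local Open Scope classical_set_scope.
Local Open Scope ring_scope.

Section Plane.
Context {R : realType}.
Implicit Types (D : set (R * R)) (p q : R * R).

Definition box (x0 x1 y0 y1 : R) : set (R * R) := `[x0, x1] `*` `[y0, y1].

Definition translation (v p : R * R) : R * R := (p.1 + v.1, p.2 + v.2).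

Definition reflection p : R * R := (- p.1, p.2).

Definition rotation p : R * R := (- p.2, p.1).

(* The group generated by the reflection, the quarter turn and the integer
   translations; no clause for inverses is needed, since the inverse of each
   generator is a product of generators. *)
Inductive lattice_symmetry : (R * R -> R * R) -> Prop :=
| symmetry_id : lattice_symmetry id
| symmetry_reflection g : lattice_symmetry g -> lattice_symmetry (reflection \o g)
| symmetry_rotation g : lattice_symmetry g -> lattice_symmetry (rotation \o g)
| symmetry_translation (k l : int) g : lattice_symmetry g ->
    lattice_symmetry (translation (k%:~R, l%:~R) \o g).

Definition concave_model : set (R * R) := [set p | p.1 <= 0 \/ p.2 <= 0].

Definition boundary D : set (R * R) := closure D `\` interior D.

Definition concave_point D p : Prop :=
  boundary D p /\
  exists g, [/\ lattice_symmetry g, g (0, 0) = p &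
    \forall q \near nbhs p, D q <-> (g @` concave_model) q].

Definition concave_points D : set (R * R) := [set p | concave_point D p].

Definition odd_point p : Prop :=
  exists k l : int, p = (k%:~R, l%:~R) /\ odd (absz (k + l)).

Definition billiard_set : set (R * R) :=
  [set p | cos (pi * p.1) = cos (pi * p.2)].

(* The region is part of the data of a curve. *)
Record curve := Curve { region : set (R * R) ; locus : set (R * R) }.

(* Meaningful when the concave points of D all have the same parity: if they
   are not odd already, moving D by (1, 0) makes them odd. *)
Definition curve_of D : curve :=
  let D' := if `[< concave_points D `<=` odd_point >] then D
            else translation (1, 0) @` D in
  Curve D' (billiard_set `&` D').

Definition L_region (s : seq (int * int)) : set (R * R) :=
  \bigcup_(c in [set` s]) box 0 c.1%:~R 0 c.2%:~R.

(* The square whose top edge is the horizontal segment of length l starting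
   at o and going right. *)
Definition add_square_below (o : R * R) (l : R) D : set (R * R) :=
  D `|` box o.1 (o.1 + l) (o.2 - l) o.2.

(* The square whose right edge is the vertical segment of length l starting
   at o and going up. *)
Definition add_square_left (o : R * R) (l : R) D : set (R * R) :=
  D `|` box (o.1 - l) o.1 o.2 (o.2 + l).

Definition area D : \bar R := (lebesgue_measure \x lebesgue_measure)%E D.

End Plane.

Arguments curve R : clear implicits.

Fixpoint P_type_pos (j : nat) : seq (int * int) :=
  match j with
  | 0 => [::] (* unused *)
  | 1 => [:: (1, 3); (2, 1)]
  | j'.+1 => (1, 2 * j%:Z + 1) ::
      [seq (c.2 + 1, c.1 + 1) | c <- rev (P_type_pos j')]
  end.

Definition P_type_neg (j : int) : seq (int * int) :=
  [seq (2 * i%:Z, - 2 * j + 1 - 2 * i%:Z) | i <- iota 1 `|j|%N].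

(* Meaningful for j other than 0 and -1. *)
Definition P_type (j : int) : seq (int * int) :=
  if 0 < j then P_type_pos `|j|%N else P_type_neg j.

Inductive sporadic_type := TypeIX | TypeX.

Section SporadicCurves.
Context {R : realType}.

(* The lower left corner of the region of type (P_type j) is the origin; its
   bottom and left edges have lengths A and B. *)
Definition sporadic_region (t : sporadic_type) (j : int) : set (R * R) :=
  let A : R := `|2 * j|%:~R in
  let B : R := `|2 * j + 1|%:~R in
  let D := L_region (P_type j) in
  match t with
  | TypeIX => add_square_left (0, - A) (A + B) (add_square_below (0, 0) A D)
  | TypeX => add_square_below (- B, 0) (A + B) (add_square_left (0, 0) B D)
  end.

Definition sporadic_curve (t : sporadic_type) (j : int) : curve R :=
  curve_of (sporadic_region t j).

End SporadicCurves.

(* The coefficient, in Berge's list, of the lens space surgery along the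
   sporadic knot of type t with parameter j. *)
Definition surgery_coefficient (t : sporadic_type) (j : int) : int :=
  match t with
  | TypeIX => 22 * j ^+ 2 + 9 * j + 1
  | TypeX => 22 * j ^+ 2 + 13 * j + 2
  end.

(* Main.v *)
Require Import Defs.
From HB Require Import structures.
From mathcomp Require Import all_boot all_order all_algebra.
From mathcomp Require Import all_classical all_reals all_analysis.
From mathcomp Require Import ring lra zify.

Import Order.TTheory GRing.Theory Num.Theory.
Import numFieldNormedType.Exports.

Local Open Scope classical_set_scope.
Local Open Scope ring_scope.

(** Gluing the two squares to the region of P(j) only moves its lower left
corner: the new sides are flush with the bottom and left edges, so the result
is the staircase with the same upper right corners (a_i, b_i), whose lower
left corner is (-(A + B), -A) for type IX and (-B, -(A + B)) for type X
([sporadic_region_staircase]).  The possible normalising translation by (1, 0)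
gives again a staircase, with all the data moved ([staircase_shift]), of the
same area and with as many concave points.

For a staircase with corners c_1, ..., c_n, ordered to the right and downwards,
the concave points are exactly the n - 1 points (a_i, b_(i+1))
([counting_concave_points]).  Each of them is visibly concave.  Conversely, a
lattice symmetry sends the model to three closed quadrants around the image of
the origin ([lattice_symmetry_concave_model]); a staircase contains, with a
point, everything below and to the left of it down to its lower left corner,
so the quadrant missing around a concave point is the upper right one.  The
point then has the abscissa of one corner and the ordinate of the next one.

The area is a sum of n slabs ([area_staircase]), so it is an integer which is
computed from the sequence alone ([staircase_area]).  Moving the lower left
corner by (-u, -v) adds u * B + v * A + u * v ([staircase_area_corner]), so
everything reduces to the area of the region of P(j).  For j > 0, the recursion
reflects the region in the diagonal, moves it by (1, 1), and adds a column of
width 1 and a row of height 1: from j - 1 to j the area grows by 4j, whence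
2j(j + 1).  For
j < -1 it is a sum of an arithmetic progression, 2j^2.  The final difference is
then 0 for j > 0 and 1 for j < -1. *)

(** * Staircase areas as integers *)

Definition below_right (c d : int * int) : bool := (c.1 < d.1) && (d.2 < c.2).

Definition right_above (o c : int * int) : bool := (o.1 < c.1) && (o.2 < c.2).

Definition swap (c : int * int) : int * int := (c.2, c.1).

Definition shift (v c : int * int) : int * int := (c.1 + v.1, c.2 + v.2).

(** The staircase with lower left corner [o] and upper right corners [s] is cut
into horizontal slabs at the heights of the corners; the slab that ends at [c]
starts at the height of the next corner, or at that of [o] for the last one. *)
Fixpoint staircase_area (o : int * int) (s : seq (int * int)) : int :=
  if s is c :: s' then
    (c.1 - o.1) * (c.2 - (head o s').2) + staircase_area o s'
  else 0.

Lemma below_right_trans : transitive below_right.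
Proof.
move=> d c e /andP[cd1 cd2] /andP[de1 de2].
by rewrite /below_right (lt_trans cd1 de1) (lt_trans de2 cd2).
Qed.

(** Cutting into vertical slabs instead: the last corner contributes a slab that
starts at the abscissa of the previous one. *)
Lemma staircase_area_rcons o s d :
  staircase_area o (rcons s d) =
  staircase_area o s + (d.1 - (last o s).1) * (d.2 - o.2).
Proof.
elim: s => [|c [|c' s] IH] /=; [by ring | by ring |].
by move: IH => /= ->; ring.
Qed.

(** Reflecting the staircase in the diagonal reverses the order of its corners
and exchanges horizontal slabs with vertical ones. *)
Lemma staircase_area_rev_swap o s :
  staircase_area (swap o) (rev (map swap s)) = staircase_area o s.
Proof.
elim: s => [//|c s IH] /=.
rewrite rev_cons staircase_area_rcons IH.
have -> : last (swap o) (rev (map swap s)) = swap (head o s).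
  by case: s {IH} => [//|c' s] /=; rewrite rev_cons last_rcons.
by rewrite /=; ring.
Qed.

Lemma staircase_area_shift v o s :
  staircase_area (shift v o) (map (shift v) s) = staircase_area o s.
Proof.
elim: s => [//|c s IH] /=; rewrite IH.
by case: s {IH} => [|c' s] /=; ring.
Qed.

(** Moving the lower left corner from [o'] to [o] adds a strip along the left
edge, a strip along the bottom edge, and the rectangle where they meet. *)
Lemma staircase_area_corner o o' c s :
  let s' := c :: s in
  staircase_area o s' = staircase_area o' s' + (o'.1 - o.1) * (c.2 - o'.2)
    + (o'.2 - o.2) * ((last c s).1 - o'.1) + (o'.1 - o.1) * (o'.2 - o.2).
Proof.
elim: s c => [|d s IH] c /=; first by ring.
by move: (IH d) => /= ->; ring.
Qed.

(** * The sequences of P(j) *)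

(** What the gluing of squares and the counting of concave points need to know
about a sequence: [A] and [B] are the lengths of the bottom and left edges of
its region, which are the largest abscissa and the largest ordinate. *)
Record L_type (m A B : int) (s : seq (int * int)) : Prop := LType {
  L_type_size : (size s)%:Z = m;
  L_type_sorted : sorted below_right s;
  L_type_pos : all (right_above (0, 0)) s;
  L_type_head : (head (0, 0) s).2 = B;
  L_type_last : (last (0, 0) s).1 = A }.

(** In the recursive step, [t] is the reflected sequence.  Its first and last
corners are the images of the last and first ones, which is why the edges of
the new region are known from those of the old one. *)
Lemma P_type_pos_shape_area (j : nat) :
  let s := P_type_pos j.+1 in
  L_type (j.+2)%:Z (2 * j.+1%:Z) (2 * j.+1%:Z + 1) s /\
  staircase_area (0, 0) s = 2 * j.+1%:Z * (j.+1%:Z + 1).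
Proof.
elim: j => [|j [[hsz hso hpos hh hl] ha]]; first by split; [split|].
have -> : P_type_pos j.+2 = (1, 2 * j.+2%:Z + 1) ::
    map (shift (1, 1)) (rev (map swap (P_type_pos j.+1))).
  by rewrite -map_rev -map_comp.
move: (P_type_pos j.+1) hsz hso hpos hh hl ha => s hsz hso hpos hh hl ha.
set t := rev (map swap s).
have tsz : size t = size s by rewrite size_rev size_map.
have tso : sorted below_right t.
  rewrite /t rev_sorted sorted_map.
  by apply: sub_sorted hso => c d /andP[h1 h2]; rewrite /below_right /= h1 h2.
have tpos : all (right_above (0, 0)) t.
  rewrite /t all_rev all_map; apply: sub_all hpos => c /andP[h1 h2].
  by rewrite /right_above /= h1 h2.
have th : (head (0, 0) t).2 = 2 * j.+1%:Z.
  rewrite -hl /t; case: (lastP s) => // s' c.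
  by rewrite map_rcons rev_rcons last_rcons.
have tl : (last (0, 0) t).1 = 2 * j.+1%:Z + 1.
  by rewrite -hh /t; case: s {hsz hso hpos hh hl ha t tsz tso tpos th} => // c s';
    rewrite /= rev_cons last_rcons.
have ta : staircase_area (0, 0) t = staircase_area (0, 0) s.
  exact: (staircase_area_rev_swap (0, 0)).
move: t tsz tso tpos th tl ta => [|c t] tsz tso tpos th tl ta.
  by move: tsz hsz => /= <-.
have upos : all (right_above (0, 0)) (map (shift (1, 1)) (c :: t)).
  by rewrite all_map; apply: sub_all tpos => x; rewrite /right_above /=; lia.
rewrite /= in tso tpos th tl.
case/andP: tpos => /andP[/= c1 c2] _.
split; first split.
- by rewrite /= size_map; move: tsz => /= ->; lia.
- rewrite /= path_map; apply/andP; split.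
    by rewrite /below_right /=; lia.
  by apply: sub_path tso => x y; rewrite /below_right /=; lia.
- by apply/andP; split; [rewrite /right_above /=; lia | exact: upos].
- by [].
- by rewrite /= last_map /= tl; lia.
(* The bottom row and the left column next to the moved region are added by
   reading the moved region from the corner (-1, -1). *)
- have := staircase_area_shift (1, 1) (-1, -1) (c :: t).
  rewrite (staircase_area_corner (-1, -1) (0, 0)) ta ha tl.
  rewrite [shift _ _]/= => /= ->; rewrite th; lia.
Qed.

Lemma P_type_neg_shape_area (m : nat) :
  let s := P_type_neg (- m.+1%:Z) in
  L_type m.+1%:Z (2 * m.+1%:Z) (2 * m.+1%:Z - 1) s /\
  staircase_area (0, 0) s = 2 * m.+1%:Z ^+ 2.
Proof.
cbv zeta; rewrite /P_type_neg abszN absz_nat.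
set f := (fun i : nat => _).
have fE i : f i = (2 * i%:Z, 2 * m.+1%:Z + 1 - 2 * i%:Z) by rewrite /f; congr pair; lia.
clearbody f.
have iota1S n : iota 1 n.+1 = rcons (iota 1 n) n.+1.
  by rewrite -[n.+1 in LHS]addn1 iotaD cats1.
have area n : staircase_area (0, 0) (map f (iota 1 n)) =
    2 * (2 * m.+1%:Z + 1) * n%:Z - 2 * n%:Z * (n%:Z + 1).
  elim: n => [|n IH]; first by rewrite /=; ring.
  rewrite iota1S map_rcons staircase_area_rcons IH.
  have -> : (last (0, 0) (map f (iota 1 n))).1 = 2 * n%:Z.
    case: n {IH} => [//|n].
    by rewrite iota1S map_rcons last_rcons fE.
  by rewrite fE /=; lia.
split; last by rewrite area expr2; ring.
split.
- by rewrite size_map size_iota.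
- rewrite sorted_map; apply: sub_sorted (iota_ltn_sorted 1 m.+1) => x y xy.
  by rewrite /= !fE /below_right /=; lia.
- rewrite all_map; apply/allP => i; rewrite mem_iota => ?.
  by rewrite /= fE /right_above /=; lia.
- by rewrite /= fE /=; lia.
- by rewrite iota1S map_rcons last_rcons fE.
Qed.

Lemma P_type_shape_area (j : int) : j <> 0 -> j <> -1 ->
  let m := if 0 < j then j + 1 else - j in
  L_type m `|2 * j| `|2 * j + 1| (P_type j) /\
  staircase_area (0, 0) (P_type j) =
    if 0 < j then 2 * j * (j + 1) else 2 * j ^+ 2.
Proof.
move=> j0 j1; rewrite /P_type; case: ltP => hj.
- case: j hj j0 j1 => [[|n]|n] // _ _ _; rewrite absz_nat.
  have [hL ->] := P_type_pos_shape_area n; split=> //.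
  rewrite !ger0_norm; [|lia..].
  by rewrite (_ : n.+1%:Z + 1 = n.+2%:Z) //; lia.
- have [n ->] : exists n : nat, j = - n.+2%:Z.
    by exists (`|j|%N.-2); lia.
  have [hL ->] := P_type_neg_shape_area n.+1; split; last by rewrite !expr2; ring.
  rewrite opprK !ler0_norm; [|lia..].
  rewrite (_ : - (2 * - n.+2%:Z) = 2 * n.+2%:Z); last by lia.
  by rewrite (_ : - (2 * - n.+2%:Z + 1) = 2 * n.+2%:Z - 1) //; lia.
Qed.

(** Abscissae increase up to that of the last corner, ordinates decrease from
that of the first. *)
Lemma L_type_bounds m A B s c : L_type m A B s -> c \in s ->
  [/\ 0 < c.1, c.1 <= A, 0 < c.2 & c.2 <= B].
Proof.
move=> [_ so pos <- <-] cs; have /andP[c1 c2] := allP pos _ cs.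
split=> //; move: cs => /(nthP (0, 0))[i i_s <-].
- case: s so i_s {pos} => [//|d s] so i_s; rewrite -nth_last.
  have : (i <= size s)%N by [].
  rewrite leq_eqVlt => /predU1P[->//|h].
  suff /andP[/ltW] : below_right (nth (0, 0) (d :: s) i) (nth (0, 0) (d :: s) (size s)) by [].
  by apply: (sorted_ltn_nth below_right_trans); rewrite ?inE.
- case: i i_s => [|i] i_s; rewrite -nth0 //.
  suff /andP[_ /ltW] : below_right (nth (0, 0) s 0) (nth (0, 0) s i.+1) by [].
  by apply: (sorted_ltn_nth below_right_trans); rewrite ?inE // (leq_ltn_trans _ i_s).
Qed.

(** * Staircases in the plane and their area *)

(** The corners are in absolute coordinates, so that changing the lower left
corner [o] leaves [s] untouched. *)
Definition staircase {R : realType} (o : int * int) (s : seq (int * int)) :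
    set (R * R) :=
  \bigcup_(c in [set` s]) box o.1%:~R c.1%:~R o.2%:~R c.2%:~R.

Lemma staircaseP {R : realType} o s (p : R * R) :
  staircase o s p <-> [/\ o.1%:~R <= p.1, o.2%:~R <= p.2 &
    exists2 c, c \in s & p.1 <= c.1%:~R /\ p.2 <= c.2%:~R].
Proof.
split.
- move=> [c /= cs [/=]]; rewrite !in_itv /= => /andP[h1 h2] /andP[h3 h4].
  by split=> //; exists c.
- move=> [h1 h2 [c cs [h3 h4]]]; exists c => //.
  by split; rewrite /= in_itv /= ?h1 ?h2 ?h3 ?h4.
Qed.

Lemma staircase_shift {R : realType} (v o : int * int) (s : seq (int * int)) :
  translation (v.1%:~R, v.2%:~R) @` staircase o s =
  staircase (shift v o) (map (shift v) s) :> set (R * R).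
Proof.
apply/seteqP; split => p.
- move=> [q /staircaseP[h1 h2 [c cs [h3 h4]]] <-]; apply/staircaseP.
  rewrite /= !intrD; split; [lra.. |].
  by exists (shift v c); [rewrite map_f | rewrite /= !intrD; lra].
- move=> /staircaseP[]; rewrite /= !intrD => h1 h2 [_ /mapP[c cs ->]].
  rewrite /= !intrD => -[h3 h4].
  exists (p.1 - v.1%:~R, p.2 - v.2%:~R); last first.
    by rewrite /translation /= !subrK -surjective_pairing.
  by apply/staircaseP; rewrite /=; split; [lra.. | exists c => //; lra].
Qed.

Lemma measurable_box {R : realType} (x0 x1 y0 y1 : R) : measurable (box x0 x1 y0 y1).
Proof. by apply: measurableX; exact: measurable_itv. Qed.

Lemma measurable_staircase {R : realType} o s :
  measurable (staircase o s : set (R * R)).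
Proof.
rewrite /staircase; apply: fin_bigcup_measurable.
  exact: finite_seq.
by move=> c _; exact: measurable_box.
Qed.

(** The slabs of a staircase are open at the bottom, except the lowest one: the
boolean selects which. *)
Lemma area_rectangle {R : realType} (b : bool) (x0 x1 y0 y1 : R) :
  x0 <= x1 -> y0 <= y1 ->
  area (`[x0, x1] `*` [set` Interval (BSide b y0) (BRight y1)]) =
  ((x1 - x0) * (y1 - y0))%:E.
Proof.
move=> x01 y01; rewrite /area product_measure1E //=; last first.
have -> : lebesgue_measure (`[x0, x1]%classic : set R) = (x1 - x0)%:E.
  rewrite lebesgue_measure_itv /= lte_fin; case: ltgtP x01 => // -> _.
  by rewrite subrr.
have -> : lebesgue_measure ([set` Interval (BSide b y0) (BRight y1)] : set R)
    = (y1 - y0)%:E.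
  rewrite lebesgue_measure_itv /= lte_fin; case: ltgtP y01 => // -> _.
  by rewrite subrr.
by rewrite EFinM.
Qed.

Lemma areaU {R : realType} (D D' : set (R * R)) :
  measurable D -> measurable D' -> D `&` D' = set0 ->
  area (D `|` D') = (area D + area D')%E.
Proof. by move=> mD mD' DD'; rewrite /area measureU. Qed.

(** Removing the first corner [c] removes the slab to the left of [c] that lies
above the next corner [c']; the slab is taken open at the bottom so that the
union is disjoint. *)
Lemma area_staircase {R : realType} o s : s <> [::] ->
  sorted below_right s -> all (right_above o) s ->
  area (staircase o s : set (R * R)) = (staircase_area o s)%:~R%:E.
Proof.
elim: s => [//|c [|c' s] IH] _.
  rewrite /= andbT => _ /andP[c1 c2].
  rewrite /staircase bigcup_seq big_seq1 area_rectangle ?ler_int ?ltW //.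
  by rewrite addr0 intrM !intrB.
rewrite [sorted _ _]/= => /andP[/andP[cc1 cc2] so].
rewrite [all _ _]/= => /andP[/andP[oc1 oc2] al].
have /andP[oc'1 oc'2] : right_above o c' by case/andP: al.
have le_c' d : d \in c' :: s -> c'.1 <= d.1 /\ d.2 <= c'.2.
  rewrite inE => /orP[/eqP -> //|ds].
  have /(_ _ ds)/andP[h1 h2] := allP (order_path_min below_right_trans so).
  by split; apply: ltW.
have -> : staircase o (c :: c' :: s) = staircase o (c' :: s) `|`
    `[o.1%:~R, c.1%:~R] `*` `]c'.2%:~R, c.2%:~R] :> set (R * R).
  apply/seteqP; split => p.
  - move=> /staircaseP[h1 h2 [d]]; rewrite inE => /orP[/eqP->{d}|ds] [h3 h4].
    + have [h5|h5] := leP p.2 c'.2%:~R; [left|right].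
        apply/staircaseP; split=> //; exists c'; rewrite ?inE ?eqxx //.
        by split=> //; rewrite (le_trans h3)// ler_int ltW.
      by split; rewrite /= in_itv /= ?h1 ?h3 ?h4 ?h5.
    + by left; apply/staircaseP; split=> //; exists d.
  - move=> [/staircaseP[h1 h2 [d ds hd]]|[/=]].
      by apply/staircaseP; split=> //; exists d => //; rewrite inE ds orbT.
    rewrite !in_itv /= => /andP[h1 h2] /andP[h3 h4]; apply/staircaseP.
    split=> //; last by exists c; rewrite ?inE ?eqxx.
    by rewrite (le_trans _ (ltW h3))// ler_int ltW.
rewrite areaU; first last.
- apply/seteqP; split=> // p [/staircaseP[_ _ [d /le_c'[_ h1] [_ h2]]] [_ /=]].
  rewrite in_itv /= => /andP[h3 _]; move: h1; rewrite -(ler_int R); lra.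
- by apply: measurableX; exact: measurable_itv.
- exact: measurable_staircase.
rewrite IH // (area_rectangle false) ?ler_int ?ltW //.
have -> : staircase_area o [:: c, c' & s] =
    (c.1 - o.1) * (c.2 - c'.2) + staircase_area o (c' :: s) by [].
move: (staircase_area o (c' :: s)) => a.
by rewrite -EFinD intrD intrM !intrB addrC.
Qed.

(** * Concave points of a staircase *)

Lemma image_cancel_comp {T U V : Type} (g : T -> U) (h : U -> V) (h' : V -> U)
    (S : set T) (q : V) :
  cancel h h' -> cancel h' h -> ((h \o g) @` S) q <-> (g @` S) (h' q).
Proof.
move=> hK hK'; split.
- by move=> [x Sx <-]; exists x; rewrite //= hK.
- by move=> [x Sx gx]; exists x; rewrite //= gx hK'.
Qed.

(** The model is a union of two half planes bounded by the axes, and each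
generator permutes such unions up to a translation of the centre.  Only the
signs of the two half planes survive. *)
Lemma lattice_symmetry_concave_model {R : realType} (g : R * R -> R * R) :
  lattice_symmetry g -> exists a b : R, [/\ a = 1 \/ a = -1, b = 1 \/ b = -1 &
    forall q, (g @` concave_model) q <->
      a * (q.1 - (g (0, 0)).1) <= 0 \/ b * (q.2 - (g (0, 0)).2) <= 0].
Proof.
elim=> {g} [|g _|g _|k l g _].
- exists 1, 1; split; [by left|by left|] => q.
  by rewrite image_id /concave_model /= !subr0 !mul1r.
- move=> [a [b [ha hb hq]]]; exists (- a), b.
  split=> // [|q]; first by case: ha => ->; [right|left]; rewrite ?opprK.
  have K : cancel (@reflection R) reflection.
    by case=> x y; congr pair; exact: opprK.
  apply: (iff_trans (image_cancel_comp _ _ _ _ _ K K)).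
  apply: (iff_trans (hq _)) => /=.
  by split=> -[?|?]; [left|right|left|right]; lra.
- move=> [a [b [ha hb hq]]]; exists (- b), a.
  split=> // [|q]; first by case: hb => ->; [right|left]; rewrite ?opprK.
  have K : cancel (@rotation R) (fun p => (p.2, - p.1)).
    by case=> x y; congr pair; exact: opprK.
  have K' : cancel (fun p => (p.2, - p.1)) (@rotation R).
    by case=> x y; congr pair; exact: opprK.
  apply: (iff_trans (image_cancel_comp _ _ _ _ _ K K')).
  apply: (iff_trans (hq _)) => /=.
  by split=> -[?|?]; [right|left|right|left]; lra.
- move=> [a [b [ha hb hq]]]; exists a, b; split=> // q.
  have K : cancel (@translation R (k%:~R, l%:~R))
      (fun p => (p.1 - k%:~R, p.2 - l%:~R)).
    by case=> x y; rewrite /translation /= !addrK.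
  have K' : cancel (fun p => (p.1 - k%:~R, p.2 - l%:~R))
      (@translation R (k%:~R, l%:~R)).
    by case=> x y; rewrite /translation /= !subrK.
  apply: (iff_trans (image_cancel_comp _ _ _ _ _ K K')).
  apply: (iff_trans (hq _)) => /=.
  by split=> -[?|?]; [left|right|left|right]; lra.
Qed.

Lemma near_plane {R : realType} (p : R * R) (P : R * R -> Prop) :
  (\forall q \near nbhs p, P q) <-> exists2 e : R, 0 < e &
    forall t u, `|t| < e -> `|u| < e -> P (p.1 + t, p.2 + u).
Proof.
split=> [/nbhs_ballP[e /= e0 H]|[e e0 H]].
- exists e => // t u te ue; apply: H; split;
  by rewrite /ball /= opprD addrA subrr sub0r normrN.
- apply/nbhs_ballP; exists e => //= q [h1 h2].
  have := H (q.1 - p.1) (q.2 - p.2).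
  rewrite ![p.1 + _]addrC ![p.2 + _]addrC !subrK -surjective_pairing.
  by apply; rewrite distrC.
Qed.

Lemma concave_point_quadrants {R : realType} (D : set (R * R)) p :
  concave_point D p -> exists a b e : R,
    [/\ a = 1 \/ a = -1, b = 1 \/ b = -1, 0 < e &
      forall t u, `|t| < e -> `|u| < e ->
        D (p.1 + t, p.2 + u) <-> a * t <= 0 \/ b * u <= 0].
Proof.
move=> [_ [g [sg gp /near_plane[e e0 H]]]].
have [a [b [ha hb hq]]] := lattice_symmetry_concave_model g sg.
exists a, b, e; split=> // t u te ue.
apply: (iff_trans (H t u te ue)); apply: (iff_trans (hq _)).
by rewrite gp /= ![_ + t]addrC ![_ + u]addrC !addrK.
Qed.

(** The inner corner between the steps [i] and [i.+1]. *)
Definition staircase_corner {R : realType} (s : seq (int * int)) (i : nat) :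
    R * R :=
  ((nth (0, 0) s i).1%:~R, (nth (0, 0) s i.+1).2%:~R).

Section Corners.
Context {R : realType} {o : int * int} {s : seq (int * int)}.
Hypotheses (s_sorted : sorted below_right s) (s_above : all (right_above o) s).

Local Notation c i := (nth (0, 0) s i).
Local Notation D := (staircase o s : set (R * R)).

Let lt_nth i k : (i < k < size s)%N -> (c i).1 < (c k).1 /\ (c k).2 < (c i).2.
Proof.
move=> /andP[ik ks]; apply/andP.
by apply: (sorted_ltn_nth below_right_trans) => //; rewrite inE (ltn_trans ik).
Qed.

Let o_lt i : (i < size s)%N -> o.1 < (c i).1 /\ o.2 < (c i).2.
Proof. by move=> i_s; apply/andP; apply: (allP s_above); rewrite mem_nth. Qed.

(** The coordinates of distinct corners differ by at least 1, so within distance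
1 only the two adjacent steps are visible. *)
Lemma staircase_corner_near i t u : (i < (size s).-1)%N ->
  `|t| < 1 -> `|u| < 1 ->
  D ((staircase_corner s i).1 + t, (staircase_corner s i).2 + u) <->
  t <= 0 \/ u <= 0.
Proof.
move=> i_s; rewrite !ltr_norml => /andP[t1 t2] /andP[u1 u2].
have i1s : (i.+1 < size s)%N by rewrite -ltn_predRL.
have is' : (i < size s)%N := ltnW i1s.
have [i1 i2] : (c i).1 < (c i.+1).1 /\ (c i.+1).2 < (c i).2.
  by apply: lt_nth; rewrite ltnSn.
have [oi1 _] := o_lt i is'; have [_ oi2] := o_lt i.+1 i1s.
move: i1 i2 oi1 oi2; rewrite -!lezD1 -!(ler_int R) !intrD => i1 i2 oi1 oi2.
apply: (iff_trans (staircaseP _ _ _)); rewrite /staircase_corner /=.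
split=> [[_ _ [d /(nthP (0, 0))[k ks <-]]] [h1 h2]|tu].
- have [ki|ik] := leqP k i; [left|right].
    move: ki; rewrite leq_eqVlt => /predU1P[ki|ki]; first by move: h1; rewrite ki; lra.
    have [] := lt_nth k i; first by rewrite ki.
    by rewrite -(ltr_int R); lra.
  move: ik; rewrite leq_eqVlt => /predU1P[ki|ki]; first by move: h2; rewrite -ki; lra.
  have [] := lt_nth i.+1 k; first by rewrite ki.
  by rewrite -!(ltr_int R); lra.
- split; [lra..|].
  by case: tu => tu; [exists (c i)|exists (c i.+1)]; rewrite ?mem_nth//; split; lra.
Qed.

Lemma concave_point_corner i : (i < (size s).-1)%N ->
  concave_point D (staircase_corner s i).
Proof.
move=> i_s; have H t u := staircase_corner_near i t u i_s.
split; first split.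
- apply: subset_closure.
  have [_] := H 0 0 ltac:(by rewrite normr0) ltac:(by rewrite normr0).
  by rewrite !addr0 -surjective_pairing; apply; left.
- rewrite /interior => /near_plane[e e0 He].
  pose t := Num.min e 1 / 2.
  have t0 : 0 < t by rewrite divr_gt0 // lt_min e0 ltr01.
  have tm : t < Num.min e 1 by rewrite ltr_pdivrMr // ltr_pMr ?ltr1n // lt_min e0 ltr01.
  have te : `|t| < e by rewrite gtr0_norm // (lt_le_trans tm)// ge_min lexx.
  have t1 : `|t| < 1 by rewrite gtr0_norm // (lt_le_trans tm)// ge_min lexx orbT.
  by have [/(_ (He t t te te))] := H t t t1 t1; lra.
- exists (translation (((nth (0, 0) s i).1)%:~R, ((nth (0, 0) s i.+1).2)%:~R) \o id).
  split.
  + by apply: symmetry_translation; exact: symmetry_id.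
  + by rewrite /translation /= !add0r.
  + apply/near_plane; exists 1 => // t u t1 u1.
    apply: (iff_trans (H t u t1 u1)); split.
    * move=> tu; exists (t, u) => //.
      by rewrite /translation /= addrC [u + _]addrC.
    * move=> [[x y]] /= xy [].
      rewrite ![_ + t]addrC ![_ + u]addrC => /addIr <- /addIr <-; exact: xy.
Qed.

(** At most one quadrant is missing around [p], so the staircase extends to
distance [t] on the left of [p] and below it; since it is closed under moving
left and down, the missing quadrant is the upper right one.  The points just
above and just to the right of [p] then belong to steps [k] and [l] whose
corners bound [p] exactly, and a step strictly between them would fill the
missing quadrant. *)
Lemma concave_point_is_corner p : concave_point D p ->
  exists2 i, (i < (size s).-1)%N & staircase_corner s i = p.
Proof.
move=> /concave_point_quadrants[a [b [e [ha hb e0 H]]]].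
pose t := e / 2.
have t0 : 0 < t by rewrite divr_gt0.
have te : `|t| < e by rewrite gtr0_norm // ltr_pdivrMr // ltr_pMr ?ltr1n.
have sign_mul x : x = 1 \/ x = -1 -> [/\ x * (x * t) = t, `|x * t| < e,
    x * t <= t & - t <= x * t].
  by case=> ->; rewrite ?mulN1r ?mul1r ?opprK ?normrN; split=> //; lra.
have [aat ate at1 at2] := sign_mul _ ha.
have [bbt bte bt1 bt2] := sign_mul _ hb.
have nate : `|- (a * t)| < e by rewrite normrN.
have nbte : `|- (b * t)| < e by rewrite normrN.
have nte : `|- t| < e by rewrite normrN.
have o1 : o.1%:~R <= p.1 - t.
  have /staircaseP[//] : D (p.1 - t, p.2 - b * t).
  by apply/H => //; right; rewrite mulrN bbt; lra.
have o2 : o.2%:~R <= p.2 - t.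
  have /staircaseP[//] : D (p.1 - a * t, p.2 - t).
  by apply/H => //; left; rewrite mulrN aat; lra.
have nD : ~ D (p.1 + a * t, p.2 + b * t) by move=> /H; rewrite aat bbt; lra.
have nDt : ~ D (p.1 + t, p.2 + t).
  move=> /staircaseP[_ _ [c cs [/= h1 h2]]]; apply: nD; apply/staircaseP.
  by rewrite /=; split; [lra..|exists c => //; lra].
have [a1 b1] : a = 1 /\ b = 1.
  split; [case: ha => // ha|case: hb => // hb]; case: nDt; apply/H => //;
    [left; rewrite ha|right; rewrite hb]; lra.
have /staircaseP[_ _ [_ /(nthP (0, 0))[k ks <-] [/= k1 k2]]] : D (p.1 + 0, p.2 + t).
  by apply/H; rewrite ?normr0 // mulr0; left.
have /staircaseP[_ _ [_ /(nthP (0, 0))[l ls <-] [/= l1 l2]]] : D (p.1 + t, p.2 + 0).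
  by apply/H; rewrite ?normr0 // mulr0; right.
rewrite !addr0 in k1 l2.
(* No corner lies strictly above and to the right of [p]. *)
have off d : d \in s -> p.1 < d.1%:~R -> d.2%:~R <= p.2.
  move=> ds h1; rewrite leNgt; apply/negP => h2.
  pose m := Num.min t (Num.min (d.1%:~R - p.1) (d.2%:~R - p.2)).
  have m0 : 0 < m by rewrite !lt_min t0 !subr_gt0 h1 h2.
  have : m <= m by []; rewrite {2}/m !le_min => /and3P[m1 m2 m3].
  have me : `|m| < e by rewrite gtr0_norm // (le_lt_trans m1)// -(gtr0_norm t0).
  have := H m m me me; rewrite a1 b1 !mul1r => -[Hm _].
  suff /Hm : D (p.1 + m, p.2 + m) by lra.
  by apply/staircaseP; rewrite /=; split; [lra..|exists d => //; lra].
have kE : p.1 = (c k).1%:~R.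
  apply/eqP; rewrite eq_le k1 /= leNgt; apply/negP => /off -/(_ (mem_nth _ ks)).
  lra.
have lE : p.2 = (c l).2%:~R.
  apply/eqP; rewrite eq_le l2 /= leNgt; apply/negP => h.
  by have := off (c l) (mem_nth _ ls); lra.
have kl : (k < l)%N.
  rewrite ltnNge leq_eqVlt; apply/negP => /predU1P[lk|lk]; first by move: l1; rewrite lk -kE; lra.
  by have [] := lt_nth l k; rewrite ?lk ?ks // -(ltr_int R) -kE => h _; lra.
exists k; first by rewrite ltn_predRL (leq_ltn_trans kl).
rewrite /staircase_corner -kE.
move: kl; rewrite leq_eqVlt => /predU1P[->|kl].
  by rewrite -lE -surjective_pairing.
have [h1 _] := lt_nth k k.+1 ltac:(by rewrite ltnSn (ltn_trans kl)).
have [_ h2] := lt_nth k.+1 l ltac:(by rewrite kl).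
move: h1 h2; rewrite -!(ltr_int R) -kE -lE => h1 h2; exfalso.
by have := off (c k.+1) (mem_nth _ (ltn_trans kl ls)) h1; lra.
Qed.

Lemma staircase_corner_inj i k :
  (i < (size s).-1)%N -> (k < (size s).-1)%N ->
  staircase_corner s i = staircase_corner s k :> R * R -> i = k.
Proof.
rewrite !ltn_predRL => i_s k_s [/eqP + _]; rewrite eqr_int => /eqP ik.
case: (ltngtP i k) => // h.
- by have [] := lt_nth i k; rewrite ?h ?(ltnW k_s) // ik ltxx.
- by have [] := lt_nth k i; rewrite ?h ?(ltnW i_s) // ik ltxx.
Qed.

Lemma counting_concave_points :
  counting (concave_points D) = (size s).-1%:R%:E :> \bar R.
Proof.
have E : (concave_points D #= `I_((size s).-1))%card.
  have -> : concave_points D = staircase_corner s @` `I_((size s).-1).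
    apply/seteqP; split=> p /=; first by move=> /concave_point_is_corner[i]; exists i.
    by move=> [i i_s <-]; exact: concave_point_corner.
  apply: inj_card_eq => i k; rewrite !inE; exact: staircase_corner_inj.
rewrite /counting asboolT; last by exists (size s).-1.
by rewrite (card_fset_set E).
Qed.
End Corners.

(** * The sporadic curves *)

Definition sporadic_corner (t : sporadic_type) (j : int) : int * int :=
  let A := `|2 * j| in let B := `|2 * j + 1| in
  match t with
  | TypeIX => (- (A + B), - A)
  | TypeX => (- B, - (A + B))
  end.

Lemma L_region_staircase {R : realType} s :
  L_region s = staircase (0, 0) s :> set (R * R).
Proof. by []. Qed.

(** The square along the bottom edge is covered by the step of the last corner
[l], which has abscissa A, and the square along the left edge by the step of
the first corner [h], which has ordinate B.  Conversely, a point of the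
staircase outside the original region has a negative coordinate, and the
bounds A and B on the coordinates place it in one of the squares. *)
Lemma sporadic_region_staircase {R : realType} t j : j <> 0 -> j <> -1 ->
  sporadic_region t j = staircase (sporadic_corner t j) (P_type j) :> set (R * R).
Proof.
move=> j0 j1; have [hL _] := P_type_shape_area j j0 j1.
rewrite /sporadic_region /sporadic_corner L_region_staircase /add_square_left /add_square_below.
have A0 : 0 <= `|2 * j| by [].
have B0 : 0 <= `|2 * j + 1| by [].
have bounds c := L_type_bounds _ _ _ _ c hL.
have [h hs [h1 h2]] : exists2 h, h \in P_type j &
    0 < h.1 /\ h.2 = `|2 * j + 1|.
  case: hL bounds => + _ _ hh _ bounds; case: (P_type j) hh bounds => [|c s] /=.
    by move=> _ _; case: ifP; lia.
  move=> hh bounds _; have cs : c \in c :: s by rewrite inE eqxx.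
  by exists c => //; have [] := bounds c cs.
have [l ls [l1 l2]] : exists2 l, l \in P_type j &
    l.1 = `|2 * j| /\ 0 < l.2.
  case: hL bounds => + _ _ _ hl bounds; case: (P_type j) hl bounds => [|c s] /=.
    by move=> _ _; case: ifP; lia.
  move=> hl bounds _; have cs : last c s \in c :: s by exact: mem_last.
  by exists (last c s) => //; have [] := bounds _ cs.
rewrite -{}h2 in B0 bounds *; rewrite -{}l1 in A0 bounds *.
move: (P_type j) hs ls bounds => s hs ls bounds {hL}.
move: A0 B0 h1 l2; rewrite -!(ler_int R) -!(ltr_int R) => A0 B0 h1 l2.
have le_l c : c \in s -> c.1%:~R <= l.1%:~R :> R.
  by move=> /bounds[_ + _ _]; rewrite ler_int.
have le_h c : c \in s -> c.2%:~R <= h.2%:~R :> R.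
  by move=> /bounds[_ _ _]; rewrite ler_int.
apply/seteqP; split=> p; case: t.
- move=> [[/staircaseP[/= p1 p2 [c cs [h3 h4]]]|]|]; last 2 first.
  + rewrite /box /= !in_itv /= => -[/andP[q1 q2] /andP[q3 q4]]; apply/staircaseP.
    by rewrite /= !intrN !intrD; split; [lra..|exists l => //; lra].
  + rewrite /box /= !in_itv /= => -[/andP[q1 q2] /andP[q3 q4]]; apply/staircaseP.
    by rewrite /= !intrN !intrD; split; [lra..|exists h => //; lra].
  + by apply/staircaseP; rewrite /= !intrN !intrD; split; [lra..|exists c].
- move=> [[/staircaseP[/= p1 p2 [c cs [h3 h4]]]|]|]; last 2 first.
  + rewrite /box /= !in_itv /= => -[/andP[q1 q2] /andP[q3 q4]]; apply/staircaseP.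
    by rewrite /= !intrN !intrD; split; [lra..|exists h => //; lra].
  + rewrite /box /= !in_itv /= => -[/andP[q1 q2] /andP[q3 q4]]; apply/staircaseP.
    by rewrite /= !intrN !intrD; split; [lra..|exists l => //; lra].
  + by apply/staircaseP; rewrite /= !intrN !intrD; split; [lra..|exists c].
- move=> /staircaseP[]; rewrite /= !intrN !intrD => p1 p2 [c cs [p3 p4]].
  have cl := le_l c cs; have ch := le_h c cs.
  have [q1|q1] := leP p.1 0.
    by right; split; rewrite /= in_itv /=; apply/andP; split; lra.
  have [q2|q2] := leP p.2 0; left; [right|left].
    by split; rewrite /= in_itv /=; apply/andP; split; lra.
  by apply/staircaseP; rewrite /=; split; [lra..|exists c].
- move=> /staircaseP[]; rewrite /= !intrN !intrD => p1 p2 [c cs [p3 p4]].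
  have cl := le_l c cs; have ch := le_h c cs.
  have [q2|q2] := leP p.2 0.
    by right; split; rewrite /= in_itv /=; apply/andP; split; lra.
  have [q1|q1] := leP p.1 0; left; [right|left].
    by split; rewrite /= in_itv /=; apply/andP; split; lra.
  by apply/staircaseP; rewrite /=; split; [lra..|exists c].
Qed.

(** The quadratic identities behind the theorem.  The number of concave points is
j for j > 0 but -j - 1 for j < 0; this and the two formulas for the area of the
region of P(j) leave the discrepancy [j < 0]. *)
Lemma staircase_sporadic_area t j : j <> 0 -> j <> -1 ->
  staircase_area (sporadic_corner t j) (P_type j) =
  surgery_coefficient t j + (size (P_type j)).-1%:Z + (j < 0)%R%:Z.
Proof.
move=> j0 j1; have [[sz _ _ hh hl] ha] := P_type_shape_area j j0 j1.
move: (P_type j) sz hh hl ha => [|c s] sz hh hl ha.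
  by move: sz => /=; case: ifP; lia.
rewrite /= in hh hl; rewrite (staircase_area_corner _ (0, 0)) {}ha hh hl.
have -> : (size (c :: s)).-1%:Z = (if 0 < j then j + 1 else - j) - 1.
  by rewrite -sz /=; lia.
case: (ltP 0 j) => hj.
- rewrite [j < 0]ltNge ltW //; case: t => /=;
  by rewrite !ger0_norm; [ring|lia..].
- rewrite (_ : (j < 0) = true); last by lia.
  case: t => /=; by rewrite !ler0_norm; [ring|lia..].
Qed.

Lemma area_minus_concave_points {R : realType} o s :
  s <> [::] -> sorted below_right s -> all (right_above o) s ->
  (area (staircase o s : set (R * R)) -
    counting (concave_points (staircase o s : set (R * R))))%E =
  (staircase_area o s - (size s).-1%:Z)%:~R%:E.
Proof.
move=> s0 so al; rewrite area_staircase // counting_concave_points //.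
by rewrite -EFinB intrB.
Qed.

(* The number of concave points is taken with values in [0, +oo], so that the
   equation also says that they are finitely many. *)
Theorem lemma1p7 (R : realType) (j : int) (t : sporadic_type)
    (hj0 : j <> 0) (hj1 : j <> -1) :
  let D : set (R * R) := region (sporadic_curve t j) in
  let delta : \bar R :=
    ((area D - counting (concave_points D)) - (surgery_coefficient t j)%:~R%:E)%E in
  delta = 0%E \/ delta = 1%E.
Proof.
move=> D delta; pose s := P_type j; pose o := sporadic_corner t j.
have [hL _] := P_type_shape_area j hj0 hj1.
have s0 : s <> [::].
  by case: hL => + _ _ _ _; rewrite -/s => + s0; rewrite s0 /=; case: ifP; lia.
have so : sorted below_right s by case: hL.
have al : all (right_above o) s.
  apply/allP => -[x y] /(L_type_bounds _ _ _ _ _ hL)[/= x0 _ y0 _].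
  have := normr_ge0 (2 * j); have := normr_ge0 (2 * j + 1).
  rewrite /o /right_above /sporadic_corner.
  by move: `|2 * j + 1| `|2 * j| => B A B0 A0; case: (t) => /=; lia.
have deficit : (area D - counting (concave_points D))%E =
    (staircase_area o s - (size s).-1%:Z)%:~R%:E.
  rewrite /D /sporadic_curve /curve_of /= sporadic_region_staircase //.
  case: ifP => _; first exact: area_minus_concave_points.
  have -> : translation (1, 0) @` staircase o s =
      staircase (shift (1, 0) o) (map (shift (1, 0)) s) :> set (R * R).
    by rewrite -staircase_shift.
  rewrite area_minus_concave_points.
  - by rewrite staircase_area_shift size_map.
  - by case: (s) s0.
  - rewrite sorted_map; apply: sub_sorted so => c d.
    by rewrite /below_right /=; lia.
  - rewrite all_map; apply: sub_all al => c.
    by rewrite /right_above; move: (o) => [x y] /=; lia.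
rewrite /delta deficit /s /o staircase_sporadic_area // -EFinB -intrB.
rewrite (_ : _ - _ - _ = (j < 0)%R%:Z); last by lia.
by case: (j < 0); [right|left].
Qed.
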